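(* Let $q,a,b$ be nonzero complex numbers with $|q|<1$ and $\max\{|ab|,|aq|,|bq|\}<1$. Then $$\frac{(q,ab;q)_\infty}{(aq,bq;q)_\infty}\;{}_3\phi_2\left(\begin{matrix}q/a,\,q/b,\,-1\\ 0,\,-q\end{matrix};q,ab\right)=\sum_{n=0}^\infty\sum_{j=-n}^n(-1)^{j}(1-q^{2n+1})\frac{(q/a,q/b;q)_n}{(aq,bq;q)_n}(ab)^nq^{n(n-1)/2+j^2}.$$
   Context: Notation: $(x;q)_0=1$, $(x;q)_n=\prod_{k=0}^{n-1}(1-xq^k)$, $(x;q)_\infty=\prod_{k=0}^\infty(1-xq^k)$, $(x_1,\dots,x_k;q)_n=(x_1;q)_n\cdots(x_k;q)_n$ (also for $n=\infty$), and $${}_3\phi_2\left(\begin{matrix}A_1,A_2,A_3\\ B_1,B_2\end{matrix};q,z\right)=\sum_{n=0}^\infty\frac{(A_1,A_2,A_3;q)_n}{(q,B_1,B_2;q)_n}z^n .$$ *)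

(* Defs.v *)
From mathcomp Require Export all_boot all_order all_algebra.
From mathcomp Require Export all_classical all_reals all_analysis.
From mathcomp Require Export complex.

Set Implicit Arguments.
Unset Strict Implicit.
Unset Printing Implicit Defensive.

Export Order.TTheory GRing.Theory Num.Theory.
Export numFieldNormedType.Exports.

Local Open Scope classical_set_scope.
Local Open Scope ring_scope.

Definition qpoch (K : pzRingType) (x q : K) (n : nat) : K :=
  \prod_(k < n) (1 - x * q ^+ k).

Definition qpochs (K : pzRingType) (xs : seq K) (q : K) (n : nat) : K :=
  \prod_(x <- xs) qpoch x q n.

(* limn is total: the values below are the intended ones only when the
   corresponding sequences converge (cvg_qpochoo, cvg_sumoo). Stating them over
   an arbitrary numFieldType makes them available for K := R[i], with the
   topology of the complex modulus. *)
Definition cvg_qpochoo (K : numFieldType) (x q : K) : Prop := cvgn (qpoch x q).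

Definition qpochoo (K : numFieldType) (x q : K) : K := limn (qpoch x q).

Definition qpochsoo (K : numFieldType) (xs : seq K) (q : K) : K :=
  \prod_(x <- xs) qpochoo x q.

Definition cvg_sumoo (K : numFieldType) (u : nat -> K) : Prop :=
  cvgn (series u).

Definition sumoo (K : numFieldType) (u : nat -> K) : K := limn (series u).

Definition phi32_term (K : fieldType) (A1 A2 A3 B1 B2 q z : K) (n : nat) : K :=
  qpochs [:: A1; A2; A3] q n / qpochs [:: q; B1; B2] q n * z ^+ n.

Definition phi32 (K : numFieldType) (A1 A2 A3 B1 B2 q z : K) : K :=
  sumoo (phi32_term A1 A2 A3 B1 B2 q z).

(* -n, ..., n *)
Definition symrange (n : nat) : seq int :=
  [seq k%:Z - n%:Z | k <- iota 0 (2 * n + 1)].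

(* Main.v *)
Require Import Defs.
From mathcomp Require Import ring lra zify.

(** Put z = ab, let A_r be the sum of (-1)^j q^(j^2) over |j| <= r, and
    alpha_r = (1 - q^(2r+1)) q^(r(r-1)/2) A_r. The sequence
    beta_n = (-1)_n / ((q)_n (-q)_n) satisfies
    beta_n = sum_(r <= n) alpha_r / ((q)_(n-r) (q)_(n+r+1)),
    which follows from two telescoping recurrences in n. Inserting this pair into
    Bailey's lemma with a finite parameter N, i.e. summing over n with the
    q-Pfaff-Saalschutz formula, gives an identity between two finite sums whose
    terms are O(z^n) uniformly in N. Letting N tend to infinity (Tannery's
    theorem) turns it into the identity to be proved. *)

Set Implicit Arguments.
Unset Strict Implicit.
Unset Printing Implicit Defensive.

Local Open Scope ring_scope.

(** * Finite q-shifted factorials over a field *)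

Section FiniteIdentities.
Variables (K : fieldType) (q : K).

Lemma qpoch0 (x : K) : qpoch x q 0 = 1.
Proof. by rewrite /qpoch big_ord0. Qed.

Lemma qpochS (x : K) n : qpoch x q n.+1 = qpoch x q n * (1 - x * q ^+ n).
Proof. by rewrite /qpoch big_ord_recr. Qed.

Lemma qpochD (x : K) m n :
  qpoch x q (m + n) = qpoch x q m * qpoch (x * q ^+ m) q n.
Proof.
elim: n => [|n IH]; first by rewrite addn0 qpoch0 mulr1.
by rewrite addnS !qpochS IH -mulrA exprD (mulrA x).
Qed.

Lemma qpoch_neq0 (x : K) n :
  (forall k, (k < n)%N -> x * q ^+ k != 1) -> qpoch x q n != 0.
Proof.
move=> hx; rewrite /qpoch prodf_seq_neq0; apply/allP => i _ /=.
by rewrite subr_eq0 eq_sym hx.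
Qed.

Hypothesis qX_neq1 : forall n, q ^+ n.+1 != 1.

Lemma qpoch_q_neq0 n : qpoch q q n != 0.
Proof. by apply: qpoch_neq0 => k _; rewrite -exprS. Qed.

Lemma subr1X_neq0 n : 1 - q ^+ n.+1 != 0.
Proof. by rewrite subr_eq0 eq_sym. Qed.

(** * The q-Pfaff-Saalschutz sum *)

Definition saalschutz_term (B C z : K) (M m : nat) : K :=
  qpoch B q m * qpoch C q m * z ^+ m * qpoch z q (M - m)
  / (qpoch q q m * qpoch (B * C * z) q m * qpoch q q (M - m)).

(* The recurrence in M satisfied by the sum telescopes in m; the right-hand side
   is the WZ certificate after p + 1 terms. *)
Lemma saal_partial (B C z : K) (E_neq1 : forall k, B * C * z * q ^+ k != 1) l p :
  let M := (p + l)%N in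
  \sum_(m < p.+1)
    ((1 - q ^+ M.+1) * (1 - B * C * z * q ^+ M) * saalschutz_term B C z M.+1 m
     - (1 - B * z * q ^+ M) * (1 - C * z * q ^+ M) * saalschutz_term B C z M m)
  = - (q ^+ l * (1 - B * q ^+ p) * (1 - C * q ^+ p) * z * saalschutz_term B C z M p).
Proof.
have E0 n : qpoch (B * C * z) q n != 0 by apply: qpoch_neq0.
have E1 n : 1 - B * C * z * q ^+ n != 0 by rewrite subr_eq0 eq_sym.
have hq := qpoch_q_neq0; have h1 := subr1X_neq0.
elim: p l => [|p IH] l /=.
  rewrite big_ord1 add0n /= /saalschutz_term !subn0 !qpoch0 expr0.
  rewrite !qpochS -exprS.
  have := h1 l; have := hq l; rewrite exprS.
  (* Powers of [q] and q-shifted factorials become independent variables; what remains is an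
     identity of rational functions. *)
  move: (q ^+ l) (qpoch q q l) (qpoch z q l) => X P Z P0 X0.
  field.
  by rewrite P0 X0.
rewrite big_ord_recr /=.
have -> : (p.+1 + l = p + l.+1)%N by rewrite addnS.
rewrite IH /saalschutz_term.
rewrite -addnS !addKn.
have -> : (p + l.+1 - p.+1 = l)%N by lia.
have -> : (p + l.+2 - p.+1 = l.+1)%N by lia.
rewrite !qpochS -!exprS.
have := h1 l.+1; have := h1 l; have := h1 p; have := hq l; have := hq p.
have := E1 p; have := E0 p.
rewrite !addnS !exprS exprD.
move: (q ^+ l) (q ^+ p) (qpoch q q l) (qpoch q q p) (qpoch z q l) (qpoch z q p) (z ^+ p) (qpoch B q p) (qpoch C q p) (qpoch _ q p) => x y P Q U V W S T X ? ? ? ? ? ? ?.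
field.
by do ?[apply/andP; split].
Qed.


(** Up to the factor (z)_M / (q)_M the left side is the balanced series 3phi2(B, C, q^(-M); B C z,
    q^(1-M)/z; q, q); the form with (z)_(M-m) / (q)_(M-m) avoids negative powers and division by
    [z]. Induction on [M]: the telescoped recurrence covers m <= M, and the term m = M + 1 is added
    separately. *)
Lemma saalschutz (B C z : K) (E_neq1 : forall k, B * C * z * q ^+ k != 1) M :
  \sum_(m < M.+1) saalschutz_term B C z M m
  = qpoch (B * z) q M * qpoch (C * z) q M
    / (qpoch q q M * qpoch (B * C * z) q M).
Proof.
have E0 n : qpoch (B * C * z) q n != 0 by apply: qpoch_neq0.
have E1 n : 1 - B * C * z * q ^+ n != 0 by rewrite subr_eq0 eq_sym.
have hq := qpoch_q_neq0; have h1 := subr1X_neq0.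
elim: M => [|M IH]; first by rewrite big_ord1 /saalschutz_term !qpoch0 expr0 !mulr1.
have := saal_partial E_neq1 0 M; rewrite /= addn0 sumrB -!mulr_sumr IH expr0 mul1r.
move/eqP; rewrite subr_eq => /eqP S.
have c0 : (1 - q ^+ M.+1) * (1 - B * C * z * q ^+ M) != 0.
  by rewrite mulf_neq0.
rewrite big_ord_recr /=; apply: (mulfI c0); rewrite mulrDr S.
rewrite /saalschutz_term !subnn !qpoch0 !qpochS -!exprS.
have := h1 M; have := hq M; have := E1 M; have := E0 M.
rewrite !exprS.
move: (q ^+ M) (qpoch q q M) (z ^+ M) (qpoch B q M) (qpoch C q M)
  (qpoch _ q M) (qpoch _ q M) (qpoch _ q M) => x P S' T U V W X ? ? ? ?.
field.
by do ?[apply/andP; split].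
Qed.

(** * An alternating sum that enters the recurrence of the Bailey pair *)

Definition dixon_term (N i : nat) : K :=
  (-1) ^+ i.+1 * q ^+ (3 * 'C(i.+1, 2)) * (1 - q ^+ i.+1)
  * (1 - q ^+ (2 * i.+1)) / (qpoch q q (N - i) * qpoch q q (N + i.+2)).

(** WZ certificate for the recurrence (1 - q^(N+1)) S_(N+1) = S_N of the sums S_N of [dixon_term].
    Writing N = p + l turns N - p into the free variable [l]; the recurrence itself is read off at l
    = 0. *)
Lemma dixon_partial l p :
  let N := (p + l)%N in
  \sum_(i < p.+1) ((1 - q ^+ N.+1) * dixon_term N.+1 i - dixon_term N i)
  = - (q ^+ l * (-1) ^+ p * q ^+ (3 * 'C(p.+2, 2)) * (1 - q ^+ p.+2)
       * (1 - q ^+ p.+1) / (qpoch q q l * qpoch q q (N + p.+3))).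
Proof.
have hq := qpoch_q_neq0; have h1 := subr1X_neq0.
elim: p l => [|p IH] l /=.
  rewrite big_ord1 add0n /= /dixon_term !subn0.
  rewrite addSn !addnS addn0 !qpochS -!exprS.
  have := h1 l; have := h1 l.+1; have := h1 l.+2; have := hq l.
  rewrite !exprS expr0.
  move: (q ^+ l) (qpoch q q l) => X P ? ? ? ?.
  field.
  by do ?[apply/andP; split].
rewrite big_ord_recr /=.
have -> : (p.+1 + l = p + l.+1)%N by rewrite addnS.
rewrite IH /dixon_term.
have -> : (p + l.+1 - p.+1 = l)%N by lia.
have -> : ((p + l.+1).+1 - p.+1 = l.+1)%N by lia.
rewrite !binS !bin1 ?bin0.
have -> : (p + l.+1 + p.+3 = p + l + p + 4)%N by lia.
have -> : ((p + l.+1).+1 + p.+3 = p + l + p + 5)%N by lia.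
have -> : (p + l.+1 + p.+4 = p + l + p + 5)%N by lia.
rewrite (addnS _ 4) (addnS _ 3) !qpochS -!exprS.
have := h1 (p + l + p + 3).+1; have := h1 (p + l + p + 3)%N; have := h1 p.
have := h1 l; have := hq l; have := hq (p + l + p + 3)%N.
move: (qpoch q q (p + l + p + 3)) (qpoch q q l) => P Q.
rewrite !(mulnDr, mulnS, exprD, exprS, expr0, muln0, addn0, mulSn, mulr1).
move: (q ^+ l) (q ^+ p) (q ^+ 'C(p, 2)) ((-1) ^+ p) => x y z e ? ? ? ? ? ?.
field.
by do ?[apply/andP; split].
Qed.


(** With k = i + 1, each [dixon_term] merges the terms k and -k of the bilateral sum of (-1)^k
    (q^(3k(k-1)/2) - q^(k(3k-1)/2)) / ((q)_(N+1-k) (q)_(N+1+k)). The value follows by induction from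
    the telescoped recurrence. *)
Lemma dixon_sum N : \sum_(i < N.+1) dixon_term N i = - (qpoch q q N)^-1.
Proof.
have hq := qpoch_q_neq0; have h1 := subr1X_neq0.
elim: N => [|N IH].
  rewrite big_ord1 /dixon_term subn0 add0n !qpochS qpoch0 /= bin_small //.
  rewrite muln0 !muln1 expr1 -!exprS !expr0 !mul1r !mulr1.
  have := h1 1%N; have := h1 0%N; rewrite expr1 => ? ?.
  field.
  by rewrite oner_neq0; do ?[apply/andP; split].
have := dixon_partial 0 N; rewrite /= addn0 sumrB -!mulr_sumr IH.
move/eqP; rewrite subr_eq => /eqP S.
rewrite big_ord_recr /=; apply: (mulfI (h1 N)); rewrite mulrDr S.
rewrite /dixon_term subnn qpoch0 !addnS !addSn.
rewrite [qpoch q q (N + N).+4]qpochS [qpoch q q N.+1]qpochS -!exprS.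
have := h1 (N + N).+3; have := h1 N; have := hq N; have := hq (N + N).+3.
move: (qpoch q q N) (qpoch q q (N + N).+3) 'C(N.+2, 2) => P Q b.
rewrite !(mulnDr, mulnS, exprD, exprS, expr0, muln0, addn0, mulSn, mulr1).
move: (q ^+ N) (q ^+ b) ((-1) ^+ N) => x y e ? ? ? ?.
field.
by do ?[apply/andP; split].
Qed.

(** * The Bailey pair built from truncated theta sums *)

Definition theta_trunc (n : nat) : K :=
  1 + \sum_(i < n) 2 * ((-1) ^+ i.+1 * q ^+ (i.+1 ^ 2)).

(** The coefficient of A_r is kept apart from A_r: it is q-hypergeometric in [n] and [r], hence has
    a WZ certificate, while A_r then enters only through its increments. *)
Definition theta_weight (n r : nat) : K :=
  (1 - q ^+ (2 * r + 1)) * q ^+ 'C(r, 2)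
  / (qpoch q q (n - r) * qpoch q q (n + r.+1)).

Lemma sqr_bin2 n : (n.+1 ^ 2 = 2 * 'C(n.+1, 2) + n.+1)%N.
Proof. by elim: n => // n IH; rewrite binS bin1; lia. Qed.

Lemma thetaS n : theta_trunc n.+1 = theta_trunc n + 2 * ((-1) ^+ n.+1 * q ^+ (n.+1 ^ 2)).
Proof. by rewrite /theta_trunc big_ord_recr /= addrA. Qed.

(* WZ certificate for theta_weight, summed by parts against theta_trunc: the
   boundary terms collected at each increment of theta_trunc are those of
   dixon_term. *)
Lemma theta_partial l p :
  let N := (p + l)%N in
  \sum_(r < p.+1) ((1 + q ^+ N.+1) * (1 - q ^+ N.+1) ^+ 2 * theta_weight N.+1 r
                   - (1 + q ^+ N) * theta_weight N r) * theta_trunc r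
  = 2 * q ^+ N.+1 * \sum_(i < p) dixon_term N i
    - q ^+ l * q ^+ 'C(p.+1, 2) * (1 - q ^+ p.+1) ^+ 2 * (1 + q ^+ p.+1)
      / (qpoch q q l * qpoch q q (N + p.+2)) * theta_trunc p.
Proof.
have hq := qpoch_q_neq0; have h1 := subr1X_neq0.
elim: p l => [|p IH] l /=.
  rewrite big_ord1 big_ord0 mulr0 add0n /= /theta_trunc big_ord0 /theta_weight !subn0.
  rewrite !muln0 !addnS addn0 bin_small // !addn0 !qpochS -!exprS !addr0.
  have := h1 l; have := h1 l.+1; have := h1 0%N; have := hq l.
  rewrite !exprS !expr0 !mulr1.
  move: (q ^+ l) (qpoch q q l) => x P ? ? ? ?.
    field.
    by do ?[apply/andP; split].
rewrite big_ord_recr /=.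
have -> : (p.+1 + l = p + l.+1)%N by rewrite addnS.
rewrite IH [in RHS]big_ord_recr /= /dixon_term /theta_weight !thetaS.
have -> : (p + l.+1 - p.+1 = l)%N by lia.
have -> : (p + l.+1 - p = l.+1)%N by lia.
have -> : ((p + l.+1).+1 - p.+1 = l.+1)%N by lia.
(* The quadratic exponent is expressed by the binomial, so that all powers of [q] become monomials
   in a few atoms. *)
rewrite sqr_bin2.
have -> : (p + l.+1 + p.+2 = p + l + p + 3)%N by lia.
have -> : ((p + l.+1).+1 + p.+2 = p + l + p + 4)%N by lia.
have -> : (p + l.+1 + p.+3 = p + l + p + 4)%N by lia.
rewrite ['C(p.+2, 2)]binS bin1.
rewrite (addnS _ 3) !qpochS -!exprS.
have := h1 (p + l + p + 3)%N; have := h1 l; have := hq l.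
have := hq (p + l + p + 3)%N.
move: (qpoch q q (p + l + p + 3)) (qpoch q q l) => P Q.
move: 'C(p.+1, 2) (\sum_(i < p) _) (theta_trunc p) => b S T.
rewrite !(mulnDr, mulnS, exprD, exprS, expr0, muln0, addn0, mulSn, mul0n, mulr1).
move: (q ^+ l) (q ^+ p) (q ^+ b) ((-1) ^+ p) => x y z e ? ? ? ?.
field.
by do ?[apply/andP; split].
Qed.


(** Both sides satisfy (1 + q^(n+1)) (1 - q^(n+1))^2 x_(n+1) - (1 + q^n) x_n = -2 q^(n+1) / (q)_n
    and agree at n = 0. On the left the inhomogeneous term is evaluated by [dixon_sum]; on the right
    it comes from (1 + q^n) (-1)_n = 2 (-q)_n. *)
Lemma theta_bailey_pair (qX_neqN1 : forall n, q ^+ n.+1 != -1) n :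
  \sum_(r < n.+1) theta_weight n r * theta_trunc r
  = qpoch (-1) q n / (qpoch q q n * qpoch (- q) q n).
Proof.
have hq := qpoch_q_neq0; have h1 := subr1X_neq0.
have hN k : qpoch (- q) q k != 0.
  by apply: qpoch_neq0 => i _; rewrite mulNr -exprS eqr_oppLR.
have h1N k : 1 + q ^+ k.+1 != 0 by rewrite addrC addr_eq0.
have hS k : (1 + q ^+ k) * qpoch (-1) q k = 2 * qpoch (- q) q k.
  have := qpochD (-1) 1 k; rewrite add1n qpochS qpochS qpoch0 expr0 expr1.
  rewrite mulN1r !mulN1r !opprK mul1r mulrC => ->.
  by congr (_ * _).
elim: n => [|n IH].
  rewrite big_ord1 /theta_weight /theta_trunc big_ord0 addr0 subn0 bin_small // !qpoch0.
  rewrite qpochS qpoch0 !mulr1 !mul1r muln0 add0n.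
  by rewrite expr1 divff ?invr1 // (h1 0%N).
have := theta_partial 0 n; rewrite /= addn0.
under eq_bigr do rewrite mulrBl -[_ * theta_weight n.+1 _ * _]mulrA -[_ * theta_weight n _ * _]mulrA.
rewrite sumrB -!mulr_sumr.
move/eqP; rewrite subr_eq IH [(1 + q ^+ n) * (_ / _)]mulrA hS => /eqP S.
have c0 : (1 + q ^+ n.+1) * (1 - q ^+ n.+1) ^+ 2 != 0.
  by rewrite mulf_neq0 // expf_neq0.
rewrite big_ord_recr /=; apply: (mulfI c0); rewrite mulrDr S.
(* The recurrence contains only the terms i < n, so the term i = n is split off from the evaluated
   sum. *)
have /eqP := dixon_sum n; rewrite big_ord_recr /= -subr_eq0 opprK -addrA addr_eq0.
move/eqP->.
rewrite thetaS /dixon_term /theta_weight !subnn sqr_bin2 !qpoch0.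
rewrite [qpoch (-1) q n.+1]qpochS mulN1r opprK [_ * (1 + q ^+ n)]mulrC hS.
rewrite [qpoch q q n.+1]qpochS [qpoch (- q) q n.+1]qpochS mulNr opprK -!exprS.
rewrite !addnS !addSn [qpoch q q (n + n).+3]qpochS -!exprS.
have := h1 (n + n).+2; have := h1 n; have := h1N n; have := hq (n + n).+2.
have := hq n; have := hN n.
move: (qpoch q q (n + n).+2) (qpoch q q n) (qpoch _ q n) => P Q M.
move: 'C(n.+1, 2) (theta_trunc n) => b T.
rewrite !(mulnDr, mulnS, exprD, exprS, expr0, muln0, addn0, mulSn, mul0n, mulr1).
move: (q ^+ n) (q ^+ b) ((-1) ^+ n) => x y e ? ? ? ? ? ?.
field.
by do ?[apply/andP; split].
Qed.

(** * Bailey's lemma for finite N *)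

Lemma triangular_sum (V : nmodType) (F : nat -> nat -> V) N :
  \sum_(n < N.+1) \sum_(r < n.+1) F n r
  = \sum_(r < N.+1) \sum_(m < (N - r).+1) F (r + m)%N r.
Proof.
elim: N => [|N IH]; first by rewrite !big_ord1 addn0.
rewrite big_ord_recr IH [in RHS]big_ord_recr /= subnn big_ord1 addn0.
rewrite [X in _ + X = _]big_ord_recr /= addrA; congr (_ + _).
rewrite -big_split /=; apply: eq_bigr => r _.
have rN : (r <= N)%N by rewrite -ltnS.
by rewrite subSn // [in RHS]big_ord_recr /= -subSn // subnKC // ltnW.
Qed.

(* Bailey's lemma relative to q, with N finite; b1 z = q^2 / b2 and
   b2 z = q^2 / b1. *)
Lemma bailey_lemma (b1 b2 z : K) (alpha : nat -> K) N
    (hz : b1 * b2 * z = q ^+ 2)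
    (c1_neq1 : forall k, b1 * z * q ^+ k != 1)
    (c2_neq1 : forall k, b2 * z * q ^+ k != 1) :
  \sum_(n < N.+1) qpoch b1 q n * qpoch b2 q n * z ^+ n
     * (qpoch z q (N - n) / qpoch q q (N - n))
     * (\sum_(r < n.+1) alpha r / (qpoch q q (n - r) * qpoch q q (n + r.+1)))
  = qpoch (b1 * z) q N * qpoch (b2 * z) q N
    * \sum_(r < N.+1) qpoch b1 q r * qpoch b2 q r * z ^+ r
        / (qpoch (b1 * z) q r * qpoch (b2 * z) q r)
        * (alpha r / (qpoch q q (N - r) * qpoch q q (N + r.+1))).
Proof.
have hq := qpoch_q_neq0.
under eq_bigr do rewrite mulr_sumr.
rewrite (triangular_sum (fun n r => qpoch b1 q n * qpoch b2 q n * z ^+ n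
     * (qpoch z q (N - n) / qpoch q q (N - n))
     * (alpha r / (qpoch q q (n - r) * qpoch q q (n + r.+1))))).
rewrite mulr_sumr; apply: eq_bigr => r _.
have rN : (r <= N)%N by rewrite -ltnS.
(* At fixed [r] the inner sum is of Saalschutz type with B = b1 q^r and C = b2 q^r. By [hz], B C z =
   q^(2r+2), which is why (q)_(n+r+1) with n = r + m splits as (q)_(2r+1) (B C z)_m. *)
have E_neq1 k : b1 * q ^+ r * (b2 * q ^+ r) * z * q ^+ k != 1.
  suff -> : b1 * q ^+ r * (b2 * q ^+ r) * z * q ^+ k = q ^+ (r + r + k).+2 by [].
  by rewrite -addn2 !exprD -hz; ring.
have c1 k : qpoch (b1 * z) q k != 0 by apply: qpoch_neq0.
have c2 k : qpoch (b2 * z) q k != 0 by apply: qpoch_neq0.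
have hE k : qpoch q q (r + k + r.+1)
   = qpoch q q (r + r.+1) * qpoch (b1 * q ^+ r * (b2 * q ^+ r) * z) q k.
  rewrite addnAC qpochD; congr (_ * qpoch _ q k).
  by rewrite addnS exprS exprD mulrA -expr2 -hz; ring.
transitivity (qpoch b1 q r * qpoch b2 q r * z ^+ r * alpha r / qpoch q q (r + r.+1)
  * \sum_(m < (N - r).+1) saalschutz_term (b1 * q ^+ r) (b2 * q ^+ r) z (N - r) m).
  rewrite mulr_sumr; apply: eq_bigr => m _.
  rewrite hE !qpochD exprD addKn subnDA /saalschutz_term.
  rewrite ![(_ * _)^-1]invfM; ring.
rewrite saalschutz //.
have hN : N = (r + (N - r))%N by rewrite subnKC.
have -> : qpoch (b1 * z) q N
    = qpoch (b1 * z) q r * qpoch (b1 * q ^+ r * z) q (N - r).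
  by rewrite [in LHS]hN qpochD mulrAC.
have -> : qpoch (b2 * z) q N
    = qpoch (b2 * z) q r * qpoch (b2 * q ^+ r * z) q (N - r).
  by rewrite [in LHS]hN qpochD mulrAC.
have -> : qpoch q q (N + r.+1) = qpoch q q (r + r.+1)
    * qpoch (b1 * q ^+ r * (b2 * q ^+ r) * z) q (N - r).
  by rewrite -hE -hN.
have hE0 : qpoch (b1 * q ^+ r * (b2 * q ^+ r) * z) q (N - r) != 0.
  by apply: qpoch_neq0.
have := hq (N - r)%N; have := c1 r; have := c2 r; have := hq (r + r.+1)%N.
move=> ? ? ? ?; field.
by do ?[apply/andP; split].
Qed.

End FiniteIdentities.

(** * Limits of sequences and series *)

Section SequenceLimits.
Local Open Scope classical_set_scope.
Variable K : numFieldType.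
Implicit Types (u v : nat -> K) (l m : K).

(* Stated over an abstract numFieldType so that R[i] gets its modulus topology
   by unification. *)
Definition tends u l : Prop := u @ \oo --> l.

Lemma tends_cvgn u l : tends u l -> cvgn u.
Proof. by move=> ul; apply/cvg_ex; exists l. Qed.

Lemma tends_limn u l : tends u l -> limn u = l.
Proof. exact: (cvg_lim (@norm_hausdorff _ _)). Qed.

Lemma cvgn_tends u : cvgn u -> tends u (limn u).
Proof. by []. Qed.

Lemma tends_unique u l m : tends u l -> tends u m -> l = m.
Proof. by move=> /tends_limn <- /tends_limn. Qed.

Lemma tends_cst l : tends (fun=> l) l.
Proof. exact: cvg_cst. Qed.

Lemma tendsD u v l m :
  tends u l -> tends v m -> tends (fun n => u n + v n) (l + m).
Proof. exact: cvgD. Qed.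

Lemma tendsM u v l m :
  tends u l -> tends v m -> tends (fun n => u n * v n) (l * m).
Proof. exact: cvgM. Qed.

Lemma tendsV u l : l != 0 -> tends u l -> tends (fun n => (u n)^-1) l^-1.
Proof. exact: cvgV. Qed.

Lemma tends_sum (m : nat) (u : nat -> nat -> K) (l : nat -> K) :
  (forall k, (k < m)%N -> tends (u^~ k) (l k)) ->
  tends (fun n => \sum_(k < m) u n k) (\sum_(k < m) l k).
Proof.
elim: m => [|m IH] h.
  by rewrite big_ord0; under eq_fun do rewrite big_ord0; exact: tends_cst.
rewrite big_ord_recr /=; under eq_fun do rewrite big_ord_recr /=.
by apply: tendsD; [apply: IH => k km; apply: h; exact: ltnW | exact: h].
Qed.

Lemma tends_shift k u l : tends u l -> tends (fun n => u (n + k)%N) l.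
Proof. by rewrite /tends -(cvg_shiftn k). Qed.

Lemma tends_center k u l : tends u l -> tends (fun n => u (n - k)%N) l.
Proof. by rewrite /tends -(cvg_centern k). Qed.

Lemma tends_sumoo u : cvg_sumoo u ->
  tends (fun n => \sum_(k < n) u k) (sumoo u).
Proof. by move=> /cvgn_tends; rewrite /sumoo seriesEord. Qed.

Lemma cvg_sumoo_tends u l :
  tends (fun n => \sum_(k < n) u k) l -> cvg_sumoo u.
Proof. by rewrite /cvg_sumoo seriesEord => /tends_cvgn. Qed.

Lemma tends_qpochoo x q : cvg_qpochoo x q -> tends (qpoch x q) (qpochoo x q).
Proof. exact: cvgn_tends. Qed.

End SequenceLimits.

(** * The complex modulus as a real number *)

Section Modulus.
Local Open Scope complex_scope.
Variable R : realType.
Implicit Types z w : R[i].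

(** The norm of [R[i]] has values in [R[i]]; moving it to [R] gives access to the total order,
    monotone convergence and [expR]. *)
Definition cmod z : R := complex.Re `|z|.

Lemma cmodE z : `|z| = (cmod z)%:C.
Proof. by rewrite /cmod RRe_real // normr_real. Qed.

Lemma cmod_ge0 z : 0 <= cmod z.
Proof. by rewrite -(lecR 0) -cmodE normr_ge0. Qed.

Lemma cmodM z w : cmod (z * w) = cmod z * cmod w.
Proof. by apply: complexI; rewrite rmorphM /= -!cmodE normrM. Qed.

Lemma cmodV z : cmod z^-1 = (cmod z)^-1.
Proof. by apply: complexI; rewrite fmorphV /= -!cmodE normfV. Qed.

Lemma cmodN z : cmod (- z) = cmod z.
Proof. by rewrite /cmod normrN. Qed.

Lemma cmod1 : cmod 1 = 1.
Proof. by rewrite /cmod normr1. Qed.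

Lemma cmodX z n : cmod (z ^+ n) = cmod z ^+ n.
Proof. by apply: complexI; rewrite rmorphXn /= -!cmodE normrX. Qed.

Lemma cmod_eq0 z : (cmod z == 0) = (z == 0).
Proof. by rewrite -(inj_eq (@complexI R)) -cmodE normr_eq0. Qed.

Lemma cmodD z w : cmod (z + w) <= cmod z + cmod w.
Proof. by rewrite -lecR rmorphD /= -!cmodE ler_normD. Qed.

Lemma cmod_lt1 z : `|z| < 1 -> cmod z < 1.
Proof. by rewrite cmodE -(ltcR _ 1). Qed.

Lemma cmod_sum n (u : nat -> R[i]) :
  cmod (\sum_(k < n) u k) <= \sum_(k < n) cmod (u k).
Proof.
elim: n => [|n IH]; first by rewrite !big_ord0 /cmod normr0.
by rewrite !big_ord_recr /= (le_trans (cmodD _ _)) // lerD2r.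
Qed.

Lemma cmod_sqrt z :
  cmod z = Num.sqrt (complex.Re z ^+ 2 + complex.Im z ^+ 2).
Proof. by rewrite /cmod normc_def. Qed.

Lemma cmod_rect (x y : R) : cmod (x +i* y) <= `|x| + `|y|.
Proof.
rewrite cmod_sqrt /= -(ger0_norm (addr_ge0 (normr_ge0 x) (normr_ge0 y))).
rewrite -sqrtr_sqr ler_wsqrtr // sqrrD !real_normK ?num_real //.
by rewrite lerD2r lerDl mulrn_wge0 // mulr_ge0.
Qed.

Lemma Re_le_cmod z : `|complex.Re z| <= cmod z.
Proof. by rewrite cmod_sqrt -sqrtr_sqr ler_wsqrtr // lerDl sqr_ge0. Qed.

Lemma Im_le_cmod z : `|complex.Im z| <= cmod z.
Proof. by rewrite cmod_sqrt -sqrtr_sqr ler_wsqrtr // lerDr sqr_ge0. Qed.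

Lemma squeeze_tends0 (u v : nat -> R) :
  (forall n, 0 <= u n <= v n) -> tends v 0 -> tends u 0.
Proof.
move=> uv v0; apply: (@squeeze_cvgr _ _ _ _ (fun=> 0) v) => //.
  exact: nearW.
exact: cvg_cst.
Qed.

(** A positive element of [R[i]] is the image of a positive real, so complex and real epsilons
    correspond. *)
Lemma cmod_tends (u : nat -> R[i]) (l : R[i]) :
  tends (fun n => cmod (l - u n)) 0 -> tends u l.
Proof.
move=> /cvgrPdist_lt h; apply/cvgrPdist_lt => e e0.
have eE : e = (complex.Re e)%:C by rewrite RRe_real // gtr0_real.
have := h (complex.Re e); rewrite -ltcR -eE => /(_ e0) [N _ hN].
exists N => // n Nn.
have : `|l - u n| < (complex.Re e)%:C.
  rewrite cmodE ltcR; have := hN n Nn.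
  by rewrite /= sub0r normrN ger0_norm ?cmod_ge0.
by rewrite -eE.
Qed.

Lemma tends_cmod (u : nat -> R[i]) (l : R[i]) :
  tends u l -> tends (fun n => cmod (l - u n)) 0.
Proof.
move=> /cvgrPdist_lt h; apply/cvgrPdist_lt => e e0.
have := h e%:C; rewrite ltcR => /(_ e0) [N _ hN].
exists N => // n Nn; have : `|l - u n| < e%:C by exact: hN.
by rewrite cmodE ltcR /= sub0r normrN ger0_norm ?cmod_ge0.
Qed.

(** * Geometric domination and Tannery's theorem *)

Lemma geometric_tail (C rho : R) (u : nat -> R) (K d : nat) :
  0 <= rho < 1 -> 0 <= C -> (forall k, u k <= C * rho ^+ k) ->
  \sum_(k < d) u (K + k)%N <= C / (1 - rho) * rho ^+ K.
Proof.
move=> /andP[r0 r1] C0 hu.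
have r1' : 0 < 1 - rho by rewrite subr_gt0.
(* The exact partial geometric sum is the bound that passes through the induction on [d]. *)
suff : \sum_(k < d) u (K + k)%N <= C / (1 - rho) * (rho ^+ K - rho ^+ (K + d)).
  move=> h; apply: le_trans h _.
  apply: ler_wpM2l; first by rewrite divr_ge0 // ltW.
  by rewrite lerBlDr lerDl exprn_ge0.
elim: d => [|d IH]; first by rewrite big_ord0 addn0 subrr mulr0.
rewrite big_ord_recr /= (le_trans (lerD IH (hu _))) // addnS exprS.
rewrite le_eqVlt; apply/orP; left; apply/eqP; field.
by rewrite gt_eqF.
Qed.

Lemma geometric_sum_le (C rho : R) (u : nat -> R) (d : nat) :
  0 <= rho < 1 -> 0 <= C -> (forall k, u k <= C * rho ^+ k) ->
  \sum_(k < d) u k <= C / (1 - rho).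
Proof.
move=> r C0 hu; have := geometric_tail 0 d r C0 hu.
by rewrite expr0 mulr1.
Qed.

Lemma real_dominated_series (C rho : R) (u : nat -> R) :
  0 <= rho < 1 -> 0 <= C -> (forall k, `|u k| <= C * rho ^+ k) ->
  cvgn (series u).
Proof.
move=> r C0 hu; apply: normed_cvg.
apply: nondecreasing_is_cvgn.
  apply/nondecreasing_seqP => n.
  by rewrite /normed_series_of !seriesEord /= big_ord_recr /= lerDl.
exists (C / (1 - rho)) => _ [n _ <-].
by rewrite /normed_series_of seriesEord; exact: geometric_sum_le.
Qed.

(** Real and imaginary parts are dominated by the modulus, so each converges as a real series;
    [cmod_rect] recombines them. *)
Lemma dominated_series (C rho : R) (u : nat -> R[i]) :
  0 <= rho < 1 -> 0 <= C -> (forall k, cmod (u k) <= C * rho ^+ k) ->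
  cvg_sumoo u.
Proof.
move=> r C0 hu.
have /tends_sumoo hx : cvg_sumoo (fun k => complex.Re (u k)).
  apply: real_dominated_series r C0 _ => k.
  exact: le_trans (Re_le_cmod _) (hu k).
have /tends_sumoo hy : cvg_sumoo (fun k => complex.Im (u k)).
  apply: real_dominated_series r C0 _ => k.
  exact: le_trans (Im_le_cmod _) (hu k).
move: hx hy; set x := sumoo _; set y := sumoo _ => hx hy.
apply: (@cvg_sumoo_tends _ _ (x +i* y)); apply: cmod_tends.
have hd (v : nat -> R) l : tends v l -> tends (fun n => `|l - v n|) 0.
  move=> /cvgrPdist_lt h; apply/cvgrPdist_lt => e /h.
  by apply: filterS => n; rewrite sub0r normrN normr_id.
have hxy : tends (fun n => `|x - \sum_(k < n) complex.Re (u k)|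
                         + `|y - \sum_(k < n) complex.Im (u k)|) 0.
  by have := tendsD (hd _ _ hx) (hd _ _ hy); rewrite addr0.
apply: squeeze_tends0 hxy => n.
rewrite cmod_ge0 /=.
have -> : \sum_(k < n) u k = (\sum_(k < n) complex.Re (u k))
                         +i* (\sum_(k < n) complex.Im (u k)).
  elim: n => [|n IH]; first by rewrite !big_ord0.
  by rewrite !big_ord_recr /= IH; case: (u n).
exact: cmod_rect.
Qed.

(** Cut at an index [K] beyond which the geometric tail is below e / 2, uniformly in N; the [K]
    remaining sequences have a sum tending to 0. *)
Lemma real_tannery (C rho : R) (h : nat -> nat -> R) :
  0 <= rho < 1 -> 0 <= C ->
  (forall N k, (k <= N)%N -> 0 <= h N k <= C * rho ^+ k) ->
  (forall k, tends (h^~ k) 0) ->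
  tends (fun N => \sum_(k < N.+1) h N k) 0.
Proof.
move=> r C0 hh hl.
have r1' : 0 < 1 - rho by rewrite subr_gt0; case/andP: r.
apply/cvgrPdist_lt => e e0.
have : tends (fun K => C / (1 - rho) * rho ^+ K) 0.
  rewrite -[X in tends _ X](mulr0 (C / (1 - rho))); apply: tendsM.
    exact: tends_cst.
  have := @cvg_expr R rho; apply.
  by case/andP: r => r0 r1; rewrite ger0_norm.
move=> /cvgrPdist_lt /(_ (e / 2)) []; first by rewrite divr_gt0.
move=> K _ /(_ K (leqnn K)) /=; rewrite sub0r normrN => hK.
have : tends (fun N => \sum_(k < K) h N k) 0.
  by have := tends_sum (fun k (_ : (k < K)%N) => hl k); rewrite big1.
move=> /cvgrPdist_lt /(_ (e / 2)) []; first by rewrite divr_gt0.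
move=> N _ hN; exists (maxn N K) => // n /=; rewrite geq_max => /andP[Nn Kn].
have h0 k : (k <= n)%N -> 0 <= h n k by move=> /hh /andP[].
rewrite sub0r normrN ger0_norm; last first.
  by apply: sumr_ge0 => k _; apply: h0; rewrite -ltnS.
have -> : \sum_(k < n.+1) h n k
    = \sum_(k < K) h n k + \sum_(k < n.+1 - K) h n (K + k)%N.
  rewrite -!(big_mkord xpredT) (big_cat_nat (n := K)) //=; last exact: leqW.
  congr (_ + _); rewrite -{1}[K]add0n big_addn big_mkord.
  by apply: eq_bigr => k _; rewrite addnC.
have := hN n Nn; rewrite /= sub0r normrN => /(le_lt_trans (ler_norm _)) h1.
have h2 := le_lt_trans (ler_norm _) hK.
suff : \sum_(k < n.+1 - K) h n (K + k)%N <= C / (1 - rho) * rho ^+ K.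
  by move=> h3; rewrite [e]splitr ltrD // (le_lt_trans h3).
(* Domination is assumed only for k <= n, whereas [geometric_tail] wants a bound for every k; hence
   the extension by 0. *)
pose u k := if (k <= n)%N then h n k else 0.
have -> : \sum_(k < n.+1 - K) h n (K + k)%N = \sum_(k < n.+1 - K) u (K + k)%N.
  by apply: eq_bigr => -[k /= kn] _; rewrite /u ifT //; lia.
apply: geometric_tail => // k; rewrite /u; case: ifP => kn.
  by case/andP: (hh _ _ kn).
by case/andP: r => r0 _; rewrite mulr_ge0 // exprn_ge0.
Qed.

(** Reduction to the real case for |g k - f N k|, which is dominated by 2 C rho^k; the tail of the
    series of [g] supplies the other half of the triangle inequality. *)
Lemma tannery (C rho : R) (f : nat -> nat -> R[i]) (g : nat -> R[i]) :
  0 <= rho < 1 -> 0 <= C ->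
  (forall N k, (k <= N)%N -> cmod (f N k) <= C * rho ^+ k) ->
  (forall k, tends (f^~ k) (g k)) ->
  cvg_sumoo g /\ tends (fun N => \sum_(k < N.+1) f N k) (sumoo g).
Proof.
move=> r C0 hf hl.
(* The bound passes to the limit: an excess of |g k| would contradict closeness to [f N k] for some
   N >= k. *)
have hg k : cmod (g k) <= C * rho ^+ k.
  rewrite leNgt; apply/negP => hlt.
  have /tends_cmod /cvgrPdist_lt := hl k.
  move=> /(_ (cmod (g k) - C * rho ^+ k)) []; first by rewrite subr_gt0.
  move=> N _ /(_ (maxn N k) (leq_maxl _ _)) /=.
  rewrite sub0r normrN ger0_norm ?cmod_ge0 // => h1.
  have h2 := hf _ _ (leq_maxr N k).
  have h3 := cmodD (g k - f (maxn N k) k) (f (maxn N k) k).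
  by rewrite subrK in h3; lra.
have cg : cvg_sumoo g := dominated_series r C0 hg.
split=> //; apply: cmod_tends.
have hd : tends (fun N => \sum_(k < N.+1) cmod (g k - f N k)) 0.
  apply: (@real_tannery (C + C) rho (fun N k => cmod (g k - f N k))) => //; first exact: addr_ge0.
  - move=> N k kN; rewrite cmod_ge0 (le_trans (cmodD _ _)) // cmodN mulrDl.
    by rewrite lerD // hf.
  - by move=> k; exact: (tends_cmod (hl k)).
have hs : tends (fun N => cmod (sumoo g - \sum_(k < N.+1) g k)) 0.
  under eq_fun do rewrite -addn1.
  exact: (tends_shift 1 (tends_cmod (tends_sumoo cg))).
have := tendsD hs hd; rewrite addr0 => hsd.
apply: squeeze_tends0 hsd => N.
rewrite cmod_ge0 /=.
rewrite -[X in cmod (_ - X)](subrK (\sum_(k < N.+1) g k)) opprD addrCA addrC.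
rewrite (le_trans (cmodD _ _)) // lerD2l opprB -sumrB.
exact: (cmod_sum _ (fun k => g k - f N k)).
Qed.

End Modulus.

(** * Bounds and limits of q-shifted factorials *)

Section QPochhammerLimits.
Variable R : realType.
Implicit Types (x q : R[i]).

(** The index type is arbitrary so that, with pairs (N, k), one bound is uniform in both indices. *)
Definition mbounded (T : Type) (f : T -> R[i]) : Prop :=
  exists C : R, forall t, cmod (f t) <= C.

Lemma mboundedM (T : Type) (f g : T -> R[i]) :
  mbounded f -> mbounded g -> mbounded (fun t => f t * g t).
Proof.
move=> [C hC] [D hD]; exists (C * D) => t.
by rewrite cmodM ler_pM ?cmod_ge0.
Qed.

Lemma mbounded_comp (S T : Type) (h : S -> T) (f : T -> R[i]) :
  mbounded f -> mbounded (fun s => f (h s)).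
Proof. by move=> [C hC]; exists C. Qed.

(** By 1 + t <= exp t the product is at most the exponential of a geometric sum. *)
Lemma mbounded_prod (a : nat -> R[i]) (c rho : R) :
  0 <= rho < 1 -> 0 <= c -> (forall k, cmod (a k) <= 1 + c * rho ^+ k) ->
  mbounded (fun n => \prod_(k < n) a k).
Proof.
move=> r c0 ha; exists (expR (c / (1 - rho))) => n.
apply: (@le_trans _ _ (expR (\sum_(k < n) c * rho ^+ k))); last first.
  by rewrite ler_expR; exact: (geometric_sum_le n r c0 (fun k => lexx _)).
elim: n => [|n IH]; first by rewrite !big_ord0 cmod1 expR0.
rewrite !big_ord_recr /= cmodM expRD ler_pM ?cmod_ge0 //.
exact: le_trans (ha n) (expR_ge1Dx _).
Qed.

Lemma mbounded_sum (u : nat -> R[i]) (c rho : R) :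
  0 <= rho < 1 -> 0 <= c -> (forall k, cmod (u k) <= c * rho ^+ k) ->
  mbounded (fun n => \sum_(k < n) u k).
Proof.
move=> r c0 hu; exists (c / (1 - rho)) => n.
exact: le_trans (cmod_sum _ _) (geometric_sum_le _ r c0 hu).
Qed.

Variable q : R[i].
Hypothesis q_lt1 : cmod q < 1.

Let rq : 0 <= cmod q < 1. Proof. by rewrite cmod_ge0. Qed.

Lemma qpoch_bounded x : mbounded (qpoch x q).
Proof.
apply: (@mbounded_prod (fun k => 1 - x * q ^+ k) _ _ rq (cmod_ge0 x)) => k.
by rewrite (le_trans (cmodD _ _)) // cmod1 cmodN cmodM cmodX.
Qed.

Lemma cmod_onem_ge x k : cmod x < 1 -> 1 - cmod x <= cmod (1 - x * q ^+ k).
Proof.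
move=> x1; have := cmodD (1 - x * q ^+ k) (x * q ^+ k).
rewrite subrK cmod1 cmodM cmodX => h; rewrite lerBlDr (le_trans h) // lerD2l.
by rewrite ler_piMr ?cmod_ge0 // exprn_ile1 ?cmod_ge0 // ltW.
Qed.

Lemma mul_qX_neq1 x k : cmod x < 1 -> x * q ^+ k != 1.
Proof.
move=> x1; rewrite eq_sym -subr_eq0 -cmod_eq0 gt_eqF //.
by rewrite (lt_le_trans _ (cmod_onem_ge k x1)) // subr_gt0.
Qed.

(** With y = x q^k, 1 / (1 - y) = 1 + y / (1 - y), and |1 - y| >= 1 - |x| makes the correction
    geometrically small. *)
Lemma qpoch_inv_bounded x : cmod x < 1 -> mbounded (fun n => (qpoch x q n)^-1).
Proof.
move=> x1; have x1' : 0 < 1 - cmod x by rewrite subr_gt0.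
suff : mbounded (fun n => \prod_(k < n) (1 - x * q ^+ k)^-1).
  by move=> [C hC]; exists C => n; rewrite /qpoch -prodfV.
apply: (@mbounded_prod (fun k => (1 - x * q ^+ k)^-1) _ _ rq
  (divr_ge0 (cmod_ge0 x) (ltW x1'))) => k.
have n0 : 1 - x * q ^+ k != 0 by rewrite subr_eq0 eq_sym mul_qX_neq1.
have -> : (1 - x * q ^+ k)^-1 = 1 + x * q ^+ k * (1 - x * q ^+ k)^-1.
  by field.
rewrite (le_trans (cmodD _ _)) // cmod1 lerD2l !cmodM cmodX cmodV.
rewrite mulrAC ler_wpM2r ?exprn_ge0 ?cmod_ge0 // ler_wpM2l ?cmod_ge0 //.
have h := cmod_onem_ge k x1.
by rewrite lef_pV2 // posrE (lt_le_trans x1').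
Qed.

(** The increments -(x)_k x q^k are geometrically small because (x)_k is bounded, and their series
    telescopes. *)
Lemma qpoch_cvg x : cvg_qpochoo x q.
Proof.
have [C hC] := qpoch_bounded x.
have C0 : 0 <= C := le_trans (cmod_ge0 _) (hC 0%N).
have /tends_sumoo : cvg_sumoo (fun k => qpoch x q k.+1 - qpoch x q k).
  apply: (@dominated_series _ (C * cmod x) (cmod q)) => //.
    by rewrite mulr_ge0 ?cmod_ge0.
  move=> k; rewrite qpochS mulrBr mulr1 addrAC subrr add0r cmodN !cmodM cmodX.
  by rewrite -mulrA ler_wpM2r // mulr_ge0 ?exprn_ge0 ?cmod_ge0.
move=> /(tendsD (tends_cst (l := 1))) h.
have e : (fun n => 1 + \sum_(k < n) (qpoch x q k.+1 - qpoch x q k)) = qpoch x q.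
  apply: boolp.funext => n; rewrite -(big_mkord xpredT (fun k => qpoch x q k.+1 - qpoch x q k)).
  by rewrite telescope_sumr // qpoch0 addrC subrK.
by rewrite e in h; exact: tends_cvgn h.
Qed.

Lemma qpoch_tends x : tends (qpoch x q) (qpochoo x q).
Proof. by apply: tends_qpochoo; exact: qpoch_cvg. Qed.

(** If the inverses are bounded by C, then |(x)_n| >= 1/C for all n, which excludes the limit 0. *)
Lemma qpochoo_neq0 x : cmod x < 1 -> qpochoo x q != 0.
Proof.
move=> x1; have [C hC] := qpoch_inv_bounded x1.
apply/negP => /eqP p0; have := qpoch_tends (x := x); rewrite p0 => /tends_cmod.
have C1 : 1 <= C by have := hC 0%N; rewrite qpoch0 invr1 cmod1.
have Cp : 0 < C := lt_le_trans ltr01 C1.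
move=> /cvgrPdist_lt /(_ C^-1); rewrite invr_gt0 => /(_ Cp) [N _ /(_ N (leqnn N))].
rewrite /= !sub0r normrN cmodN ger0_norm ?cmod_ge0 // ltNge => /negP; apply.
have n0 : qpoch x q N != 0 by apply: qpoch_neq0 => k _; exact: mul_qX_neq1.
have := hC N; rewrite cmodV => h.
by rewrite -[leRHS]invrK lef_pV2 // posrE invr_gt0 lt_neqAle eq_sym cmod_eq0 n0 cmod_ge0.
Qed.

Lemma qpoch_inv_tends x :
  cmod x < 1 -> tends (fun n => (qpoch x q n)^-1) (qpochoo x q)^-1.
Proof. by move=> x1; apply: tendsV; [exact: qpochoo_neq0 | exact: qpoch_tends]. Qed.

(** Since (i + 1)^2 >= i, the terms are dominated by |2| |q|^i. *)
Lemma theta_bounded : mbounded (theta_trunc q).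
Proof.
have [C hC] : mbounded (fun n => \sum_(i < n) 2 * ((-1) ^+ i.+1 * q ^+ (i.+1 ^ 2))).
  apply: (@mbounded_sum (fun i => 2 * ((-1) ^+ i.+1 * q ^+ (i.+1 ^ 2))) (cmod 2) (cmod q)) => //.
    exact: cmod_ge0.
  move=> i; rewrite !cmodM !cmodX cmodN cmod1 expr1n mul1r ler_wpM2l ?cmod_ge0 //.
  by rewrite ler_wiXn2l ?cmod_ge0 ?ltW //; lia.
by exists (1 + C) => n; rewrite /theta_trunc (le_trans (cmodD _ _)) // cmod1 lerD2l.
Qed.

End QPochhammerLimits.

(** * Preparations for the passage to the limit *)

Lemma cvg_sumooZ (K : numFieldType) (c : K) (u : nat -> K) :
  cvg_sumoo u ->
  cvg_sumoo (fun n => c * u n) /\ sumoo (fun n => c * u n) = c * sumoo u.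
Proof.
move=> cu.
have h : tends (fun n => \sum_(k < n) c * u k) (c * sumoo u).
  under eq_fun do rewrite -mulr_sumr.
  by apply: tendsM; [exact: tends_cst | exact: tends_sumoo].
split; first exact: cvg_sumoo_tends h.
by apply: (tends_unique _ h); apply: tends_sumoo; exact: cvg_sumoo_tends h.
Qed.

Lemma tannery_power (R : realType) (F : nat -> nat -> R[i]) (G : nat -> R[i])
    (z : R[i]) :
  cmod z < 1 -> mbounded (fun p : nat * nat => F p.1 p.2) ->
  (forall k, tends (F^~ k) (G k)) ->
  cvg_sumoo (fun k => G k * z ^+ k) /\
  tends (fun N => \sum_(k < N.+1) F N k * z ^+ k)
    (sumoo (fun k => G k * z ^+ k)).
Proof.
move=> z1 [C hC] hF.
have C0 : 0 <= C := le_trans (cmod_ge0 _) (hC (0, 0)%N).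
apply: (@tannery _ C (cmod z) (fun N k => F N k * z ^+ k)).
- by rewrite cmod_ge0.
- exact: C0.
- move=> N k _; rewrite cmodM cmodX ler_wpM2r ?exprn_ge0 ?cmod_ge0 //.
  exact: (hC (N, k)).
- by move=> k; apply: tendsM; [exact: hF | exact: tends_cst].
Qed.

(** * Rewriting the sums and products of the statement *)

Lemma sum_symrange (V : zmodType) (F : int -> V) n :
  \sum_(j <- symrange n) F j
  = F 0 + \sum_(i < n) (F i.+1%:Z + F (- i.+1%:Z)).
Proof.
rewrite /symrange big_map.
have -> : iota 0 (2 * n + 1) = index_iota 0 (2 * n + 1) by rewrite /index_iota subn0.
rewrite (big_cat_nat (n := n)) //=; last by lia.
have -> : \sum_(n <= i < 2 * n + 1) F (i%:Z - n%:Z) = \sum_(i < n.+1) F i%:Z.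
  rewrite -{1}[n]add0n big_addn.
  have -> : (2 * n + 1 - n = n.+1)%N by lia.
  by rewrite big_mkord; apply: eq_bigr => i _; rewrite PoszD addrK.
(* Reversing the negative half puts -(i + 1) in position i, opposite to i + 1. *)
rewrite big_nat_rev big_mkord big_ord_recl /= addrCA -big_split /=.
congr (_ + _); apply: eq_bigr => i _; rewrite addrC; congr (F _ + F _).
by have := ltn_ord i; lia.
Qed.

(** The quotient by 2 is exact, being 'C(n, 2), also for n = 0 where n - 1 is truncated. All
    exponents of [q] are nonnegative, so integer powers become natural ones. *)
Lemma sum_symrange_theta (K : fieldType) (q X Y Z : K) n :
  \sum_(j <- symrange n)
    (-1) ^ j * X * Y * Z * q ^ (((n * (n - 1)) %/ 2)%:Z + j ^+ 2)
  = X * Y * Z * q ^+ 'C(n, 2) * theta_trunc q n.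
Proof.
have -> : ((n * (n - 1)) %/ 2)%N = 'C(n, 2) by rewrite bin2 divn2 subn1.
rewrite sum_symrange expr0z mul1r expr0n /= addr0 -exprnP /theta_trunc mulrDr mulr1.
congr (_ + _); rewrite mulr_sumr; apply: eq_bigr => i _.
rewrite sqrrN expr2 -PoszM mulnn -PoszD -!exprnP -exprnN -exprVn invrN1 exprD.
ring.
Qed.

Lemma qpochs2 (K : pzRingType) (x y q : K) n :
  qpochs [:: x; y] q n = qpoch x q n * qpoch y q n.
Proof. by rewrite /qpochs !big_cons big_nil mulr1. Qed.

Lemma qpochs3 (K : pzRingType) (x y z q : K) n :
  qpochs [:: x; y; z] q n = qpoch x q n * (qpoch y q n * qpoch z q n).
Proof. by rewrite /qpochs !big_cons big_nil mulr1. Qed.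

Lemma qpochsoo2 (K : numFieldType) (x y q : K) :
  qpochsoo [:: x; y] q = qpochoo x q * qpochoo y q.
Proof. by rewrite /qpochsoo !big_cons big_nil mulr1. Qed.

Lemma qpoch_zero (K : pzRingType) (q : K) n : qpoch 0 q n = 1.
Proof. by rewrite /qpoch big1 // => k _; rewrite mul0r subr0. Qed.

Lemma mbounded_expr (R : realType) (q : R[i]) :
  cmod q < 1 -> mbounded (fun n => q ^+ n).
Proof.
by move=> q1; exists 1 => n; rewrite cmodX exprn_ile1 ?cmod_ge0 // ltW.
Qed.

Lemma mbounded_onem_expr (R : realType) (q : R[i]) :
  cmod q < 1 -> mbounded (fun n => 1 - q ^+ n).
Proof.
move=> /mbounded_expr [C hC]; exists (1 + C) => n.
by rewrite (le_trans (cmodD _ _)) // cmod1 cmodN lerD2l.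
Qed.

Theorem theorem3p6 (R : realType) (q a b : R[i])
  (q_neq0 : q != 0) (a_neq0 : a != 0) (b_neq0 : b != 0)
  (q_lt1 : `|q| < 1)
  (ab_lt1 : `|a * b| < 1) (aq_lt1 : `|a * q| < 1) (bq_lt1 : `|b * q| < 1) :
  let lhs_term : nat -> R[i] :=
    phi32_term (q / a) (q / b) (-1) 0 (- q) q (a * b) in
  let rhs_term : nat -> R[i] := fun n =>
    \sum_(j <- symrange n)
      (-1) ^ j * (1 - q ^+ (2 * n + 1))
      * (qpochs [:: q / a; q / b] q n / qpochs [:: a * q; b * q] q n)
      * (a * b) ^+ n * q ^ (((n * (n - 1)) %/ 2)%:Z + j ^+ 2) in
  [/\ (forall x, x \in [:: q; a * b; a * q; b * q] -> cvg_qpochoo x q),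
      cvg_sumoo lhs_term,
      cvg_sumoo rhs_term &
      qpochsoo [:: q; a * b] q / qpochsoo [:: a * q; b * q] q
        * phi32 (q / a) (q / b) (-1) 0 (- q) q (a * b)
      = sumoo rhs_term].
Proof.
move=> lhs_term rhs_term.
have {q_lt1}q1 := cmod_lt1 q_lt1; have {ab_lt1}z1 := cmod_lt1 ab_lt1.
have {aq_lt1}aq1 := cmod_lt1 aq_lt1; have {bq_lt1}bq1 := cmod_lt1 bq_lt1.
have Nq1 : cmod (- q) < 1 by rewrite cmodN.
set z := a * b in z1 lhs_term rhs_term *.
(* The choice that meets the condition b1 b2 z = q^2 of [bailey_lemma] and turns b1 z, b2 z into the
   denominators bq, aq of the theorem. *)
pose b1 := q / a; pose b2 := q / b.
have hz : b1 * b2 * z = q ^+ 2 by rewrite /b1 /b2 /z; field; rewrite ?a_neq0 ?b_neq0.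
have c1E : b1 * z = b * q by rewrite /b1 /z; field.
have c2E : b2 * z = a * q by rewrite /b2 /z; field.
have qX_neq1 n : q ^+ n.+1 != 1 by rewrite exprS mul_qX_neq1.
have qX_neqN1 n : q ^+ n.+1 != -1.
  by rewrite -eqr_oppLR exprS -mulNr mul_qX_neq1.
have zoo0 := qpochoo_neq0 q1 z1; have qoo0 := qpochoo_neq0 q1 q1.
have aqoo0 := qpochoo_neq0 q1 aq1; have bqoo0 := qpochoo_neq0 q1 bq1.
pose beta n := qpoch (-1) q n * (qpoch q q n)^-1 * (qpoch (- q) q n)^-1.
(* [F] and [H] collect everything but the power of [z]: they are bounded uniformly in N and converge
   for fixed second index, as [tannery_power] requires. *)
pose F N n := qpoch b1 q n * qpoch b2 q n * beta n
  * (qpoch z q (N - n) * (qpoch q q (N - n))^-1).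
pose alpha r := (1 - q ^+ (2 * r + 1)) * q ^+ 'C(r, 2) * theta_trunc q r.
pose w r := qpoch b1 q r * qpoch b2 q r
  * (qpoch (b * q) q r)^-1 * (qpoch (a * q) q r)^-1.
pose H N r := w r * alpha r
  * ((qpoch q q (N - r))^-1 * (qpoch q q (N + r.+1))^-1).
have finite N : \sum_(n < N.+1) F N n * z ^+ n
    = qpoch (b * q) q N * qpoch (a * q) q N * \sum_(r < N.+1) H N r * z ^+ r.
  have := bailey_lemma qX_neq1 alpha N hz; rewrite c1E c2E.
  move=> /(_ (fun k => mul_qX_neq1 q1 k bq1) (fun k => mul_qX_neq1 q1 k aq1)).
  move=> bailey; etransitivity; last (etransitivity; first exact: bailey).
    apply: eq_bigr => n _; rewrite /F.
    have -> : beta n = \sum_(r < n.+1) alpha r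
        / (qpoch q q (n - r) * qpoch q q (n + r.+1)).
      rewrite /beta -mulrA -invfM -(theta_bailey_pair qX_neq1 qX_neqN1).
      by apply: eq_bigr => r _; rewrite /theta_weight mulrAC.
    by move: (\sum_(_ < _) _) => S; ring.
  congr (_ * _); apply: eq_bigr => r _; rewrite /H /w !invfM; ring.
have bd x : mbounded (qpoch x q) := qpoch_bounded q1 x.
have bdV x (x1 : cmod x < 1) := qpoch_inv_bounded q1 x1.
have [cF tF] : cvg_sumoo (fun n => qpoch b1 q n * qpoch b2 q n * beta n
       * (qpochoo z q * (qpochoo q q)^-1) * z ^+ n) /\
    tends (fun N => \sum_(n < N.+1) F N n * z ^+ n)
      (sumoo (fun n => qpoch b1 q n * qpoch b2 q n * beta n
       * (qpochoo z q * (qpochoo q q)^-1) * z ^+ n)).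
  apply: (tannery_power (F := F) z1).
    apply: mboundedM.
      apply: (mbounded_comp snd (f := fun n => qpoch b1 q n * qpoch b2 q n * beta n)).
      apply: mboundedM; first exact: mboundedM.
      by apply: mboundedM; [apply: mboundedM => //|]; apply: bdV.
    (* Truncated subtraction keeps the index in the range of the sequence, so the bound also covers
       pairs with n > N. *)
    apply: (mbounded_comp (fun p => p.1 - p.2)%N
      (f := fun n => qpoch z q n * (qpoch q q n)^-1)).
    by apply: mboundedM => //; exact: bdV.
  move=> n; apply: tendsM; first exact: tends_cst.
  apply: (tends_center n (u := fun m => qpoch z q m * (qpoch q q m)^-1)).
  by apply: tendsM; [exact: qpoch_tends | exact: qpoch_inv_tends].
have [cH tH] : cvg_sumoo (fun n => w n * alpha n
       * ((qpochoo q q)^-1 * (qpochoo q q)^-1) * z ^+ n) /\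
    tends (fun N => \sum_(r < N.+1) H N r * z ^+ r)
      (sumoo (fun n => w n * alpha n
       * ((qpochoo q q)^-1 * (qpochoo q q)^-1) * z ^+ n)).
  apply: (tannery_power (F := H) z1).
    apply: mboundedM.
      apply: (mbounded_comp snd (f := fun n => w n * alpha n)).
      apply: mboundedM.
        by apply: mboundedM; [apply: mboundedM; first exact: mboundedM|];
          apply: bdV.
      apply: mboundedM; last exact: theta_bounded.
      apply: mboundedM; last first.
        exact: (mbounded_comp (fun n => 'C(n, 2)) (mbounded_expr q1)).
      exact: (mbounded_comp (fun n => 2 * n + 1)%N (mbounded_onem_expr q1)).
    apply: mboundedM.
      exact: (mbounded_comp (fun p => p.1 - p.2)%N (bdV q q1)).
    exact: (mbounded_comp (fun p => p.1 + p.2.+1)%N (bdV q q1)).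
  move=> n; apply: tendsM; first exact: tends_cst.
  apply: tendsM.
    apply: (tends_center n (u := fun m => (qpoch q q m)^-1)).
    exact: qpoch_inv_tends.
  apply: (tends_shift n.+1 (u := fun m => (qpoch q q m)^-1)).
  exact: qpoch_inv_tends.
(* The limit terms carry the constant (z)_oo / (q)_oo; its inverse is pulled out as the factor. *)
have lE : lhs_term = fun n => (qpochoo q q / qpochoo z q) *
    (qpoch b1 q n * qpoch b2 q n * beta n
       * (qpochoo z q * (qpochoo q q)^-1) * z ^+ n).
  apply: boolp.funext => n; rewrite /lhs_term /phi32_term.
  rewrite !qpochs3 qpoch_zero mul1r /beta.
  (* Stated for variables of an arbitrary field, so that [field] treats the infinite products as
     opaque. *)
  have cancel (K : fieldType) (Q Z B1 B2 M P N X : K) : Q != 0 -> Z != 0 ->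
      B1 * (B2 * M) / (P * N) * X
      = Q / Z * (B1 * B2 * (M * P^-1 * N^-1) * (Z * Q^-1) * X).
    by move=> Q0 Z0; rewrite invfM; move: P^-1 N^-1 => P' N'; field; rewrite Q0 Z0.
  exact (cancel _ _ _ _ _ _ _ _ _ qoo0 zoo0).
have rE : rhs_term = fun n => qpochoo q q * qpochoo q q *
    (w n * alpha n * ((qpochoo q q)^-1 * (qpochoo q q)^-1) * z ^+ n).
  apply: boolp.funext => n; rewrite /rhs_term sum_symrange_theta.
  rewrite !qpochs2 /w /alpha.
  have cancel (K : fieldType) (Q B1 B2 X A B Y V T : K) : Q != 0 ->
      X * (B1 * B2 / (A * B)) * Y * V * T
      = Q * Q * (B1 * B2 * B^-1 * A^-1 * (X * V * T) * (Q^-1 * Q^-1) * Y).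
    by move=> Q0; rewrite invfM; move: A^-1 B^-1 => A' B'; field; rewrite Q0.
  exact (cancel _ _ _ _ _ _ _ _ _ _ qoo0).
have [cl sl] := cvg_sumooZ (qpochoo q q / qpochoo z q) cF.
have [cr sr] := cvg_sumooZ (qpochoo q q * qpochoo q q) cH.
split.
- by move=> x _; exact: qpoch_cvg.
- by rewrite lE.
- by rewrite rE.
rewrite /phi32 -/lhs_term lE rE sl sr.
have tB : tends (fun N => qpoch (b * q) q N * qpoch (a * q) q N)
    (qpochoo (b * q) q * qpochoo (a * q) q).
  by apply: tendsM; exact: qpoch_tends.
(* By [finite] the two sides are one and the same sequence in N; uniqueness of its limit gives the
   identity. *)
have := tendsM tB tH; under eq_fun do rewrite -finite.
move=> /(tends_unique tF) ->.
rewrite !qpochsoo2.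
have cancel (K : fieldType) (Q Z A B S : K) :
    Z != 0 -> A != 0 -> B != 0 ->
    Q * Z / (A * B) * (Q / Z * (B * A * S)) = Q * Q * S.
  by move=> Z0 A0 B0; field; rewrite Z0 A0 B0.
exact (cancel _ _ _ _ _ _ zoo0 aqoo0 bqoo0).
Qed.
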